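(* The $\mathrm{des}$-Wilf equivalence classes of quasi-consecutive patterns of lengths $2$, $3$ and $4$ are as follows. Length 2: there are exactly two classes, $\{\underline{1}2\}$ and $\{\underline{2}1\}$. Length 3: there are exactly five classes, $\{\underline{12}3\}$, $\{\underline{32}1\}$, $\{\underline{21}3\}$, $\{\underline{23}1\}$, $\{\underline{13}2,\underline{31}2\}$. Length 4: there are exactly fourteen classes: $\{\underline{312}4,\underline{231}4,\underline{241}3\}$, $\{\underline{213}4,\underline{132}4,\underline{142}3\}$, $\{\underline{243}1,\underline{324}1,\underline{314}2\}$, $\{\underline{342}1,\underline{423}1,\underline{413}2\}$, $\{\underline{134}2,\underline{124}3\}$, $\{\underline{431}2,\underline{421}3\}$, $\{\underline{123}4\}$, $\{\underline{321}4\}$, $\{\underline{214}3\}$, $\{\underline{412}3\}$, $\{\underline{143}2\}$, $\{\underline{341}2\}$, $\{\underline{234}1\}$, $\{\underline{432}1\}$. That is, two quasi-consecutive patterns of the same length ($2$, $3$ or $4$) are $\mathrm{des}$-Wilf equivalent if and only if they lie in the same listed class.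
   Context: $\mathfrak{S}_n$ is the set of permutations of $\{1,\ldots,n\}$ in one-line notation, and $\mathrm{des}(\pi)=|\{i\in[n-1]:\pi_i>\pi_{i+1}\}|$. A quasi-consecutive pattern of length $k$ is a permutation $\omega_1\cdots\omega_k\in\mathfrak{S}_k$ written $\underline{\omega_1\cdots\omega_{k-1}}\omega_k$. An occurrence of it in $\pi\in\mathfrak{S}_n$ is a subsequence $\pi_i\pi_{i+1}\cdots\pi_{i+k-2}\pi_j$ with $j>i+k-2$ that is order-isomorphic to $\omega_1\cdots\omega_k$ (the first $k-1$ letters are adjacent in $\pi$; the last need not be adjacent to them). $\mathfrak{S}_n(\omega)$ is the set of permutations in $\mathfrak{S}_n$ with no occurrence of $\omega$. Two patterns $\omega,\omega'$ are $\mathrm{des}$-Wilf equivalent, written $\omega\overset{\mathrm{des}}{\sim}\omega'$, if $|\{\pi\in\mathfrak{S}_n(\omega):\mathrm{des}(\pi)=m\}|=|\{\pi\in\mathfrak{S}_n(\omega'):\mathrm{des}(\pi)=m\}|$ for all $n\ge1$ and $m\ge0$. *)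

(* Defs.v *)
From mathcomp Require Import all_boot all_fingroup.

Set Implicit Arguments.
Unset Strict Implicit.
Unset Printing Implicit Defensive.

(* The symmetric group 'S_n acts on {0, ..., n-1}: the word below shifts the
   letters to {1, ..., n}, while positions in a word are counted from 0. *)
Definition oneline n (p : 'S_n) : seq nat := [seq (val (p i)).+1 | i : 'I_n].

Definition des n (p : 'S_n) : nat :=
  #|[set i : 'I_n.-1 | nth 0 (oneline p) i.+1 < nth 0 (oneline p) i]|.

Definition order_isomorphic (u v : seq nat) : bool :=
  (size u == size v) &&
  [forall a : 'I_(size u), forall b : 'I_(size u),
     (nth 0 u a < nth 0 u b) == (nth 0 v a < nth 0 v b)].

(* A permutation w of length k >= 2 is read as the quasi-consecutive pattern
   whose first k - 1 letters are underlined. *)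
Definition qc_occurrence k n (w : 'S_k) (p : 'S_n) (i j : 'I_n) : bool :=
  (i + k.-2 < j) &&
  order_isomorphic
    (rcons [seq nth 0 (oneline p) (i + a) | a <- iota 0 k.-1]
           (nth 0 (oneline p) j))
    (oneline w).

Definition qc_avoids k n (w : 'S_k) (p : 'S_n) : bool :=
  ~~ [exists i : 'I_n, exists j : 'I_n, qc_occurrence w p i j].

Definition des_Wilf_equiv k (w w' : 'S_k) : Prop :=
  forall n m : nat, 1 <= n ->
    #|[set p : 'S_n | qc_avoids w p && (des p == m)]| =
    #|[set p : 'S_n | qc_avoids w' p && (des p == m)]|.

Definition des_Wilf_class k (C : {set 'S_k}) : Prop :=
  exists w : 'S_k, forall w' : 'S_k, w' \in C <-> des_Wilf_equiv w w'.

(* The sets of permutations given by a list of lists of one-line words. *)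
Definition listed_classes k (L : seq (seq (seq nat))) : {set {set 'S_k}} :=
  [set:: [seq [set w : 'S_k | oneline w \in l] | l <- L]].

Definition classes2 : seq (seq (seq nat)) :=
  [:: [:: [:: 1; 2]];
      [:: [:: 2; 1]]].

Definition classes3 : seq (seq (seq nat)) :=
  [:: [:: [:: 1; 2; 3]];
      [:: [:: 3; 2; 1]];
      [:: [:: 2; 1; 3]];
      [:: [:: 2; 3; 1]];
      [:: [:: 1; 3; 2]; [:: 3; 1; 2]]].

Definition classes4 : seq (seq (seq nat)) :=
  [:: [:: [:: 3; 1; 2; 4]; [:: 2; 3; 1; 4]; [:: 2; 4; 1; 3]];
      [:: [:: 2; 1; 3; 4]; [:: 1; 3; 2; 4]; [:: 1; 4; 2; 3]];
      [:: [:: 2; 4; 3; 1]; [:: 3; 2; 4; 1]; [:: 3; 1; 4; 2]];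
      [:: [:: 3; 4; 2; 1]; [:: 4; 2; 3; 1]; [:: 4; 1; 3; 2]];
      [:: [:: 1; 3; 4; 2]; [:: 1; 2; 4; 3]];
      [:: [:: 4; 3; 1; 2]; [:: 4; 2; 1; 3]];
      [:: [:: 1; 2; 3; 4]];
      [:: [:: 3; 2; 1; 4]];
      [:: [:: 2; 1; 4; 3]];
      [:: [:: 4; 1; 2; 3]];
      [:: [:: 1; 4; 3; 2]];
      [:: [:: 3; 4; 1; 2]];
      [:: [:: 2; 3; 4; 1]];
      [:: [:: 4; 3; 2; 1]]].

(* Main.v *)
Require Import Defs.
From mathcomp Require Import all_boot all_fingroup all_algebra.
From mathcomp Require Import zify ring.

Set Implicit Arguments.
Unset Strict Implicit.
Unset Printing Implicit Defensive.

(* Classes are separated by counting for n <= 6. Complementation, which turns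
   des into n - 1 - des, reduces the equivalences to six.

   For 3124 ~ 2314 and 2134 ~ 1324 the last letter of the pattern is its
   maximum: cutting a permutation at its right-to-left maxima leaves blocks that
   have to avoid the consecutive pattern of the first three letters, and
   reverse-complementing each block exchanges the two patterns.

   For the others, a permutation is built from right to left and encoded by the
   rank of each new letter among those to its right. Avoidance becomes a local
   condition on two or three consecutive ranks and descents become ascents of the
   ranks, so both sides satisfy transfer recurrences. For 1324 ~ 1423 and
   2314 ~ 2413 the conditions force the same peaks of the code to be as large as
   possible, respectively as small as possible; for 1342 ~ 1243 they leave only two
   values to each weakly decreasing run, with all letters but the first, or all but
   the last, being equal. For 132 ~ 312 both generating functions are binomial
   transforms of weighted Motzkin paths, whose up- and down-weights are exchanged;
   these agree at height 0. *)

(** * Words *)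

(** Unlike [order_isomorphic], this form evaluates well under [vm_compute], on which the counts
    separating the classes rely. *)
Definition oiso (u v : seq nat) : bool :=
  (size u == size v) &&
  all (fun a => all (fun b => (nth 0 u a < nth 0 u b) == (nth 0 v a < nth 0 v b))
                    (iota 0 (size u))) (iota 0 (size u)).

(** The test [v != [::]] keeps the last letter from being compared with the default [0]. *)
Fixpoint wdes (u : seq nat) : nat :=
  if u is x :: v then (v != [::]) && (head 0 v < x) + wdes v else 0.

(** Only occurrences starting at the first letter of [u] count here; if [u] is too short, the [drop]
    is empty and there is none. *)
Definition occurs_at (om u : seq nat) : bool :=
  has (fun d => oiso (rcons (take (size om).-1 u) d) om) (drop (size om).-1 u).

Fixpoint avoids (om u : seq nat) : bool :=
  if u is x :: v then ~~ occurs_at om u && avoids om v else true.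

Definition num_avoiders (om : seq nat) (n m : nat) : nat :=
  count (fun u => avoids om u && (wdes u == m)) (permutations (iota 0 n)).

Lemma oisoP u v :
  reflect (size u = size v /\
    forall a b, a < size u -> b < size u ->
      (nth 0 u a < nth 0 u b) = (nth 0 v a < nth 0 v b)) (oiso u v).
Proof.
apply: (iffP andP) => -[/eqP e H]; split=> //.
- move=> a b la lb; move/allP: H => /(_ a); rewrite mem_iota la => /(_ isT).
  by move/allP/(_ b); rewrite mem_iota lb => /(_ isT)/eqP.
- apply/allP => a; rewrite mem_iota => /andP[_ la].
  by apply/allP => b; rewrite mem_iota => /andP[_ lb]; rewrite H.
Qed.

Lemma order_isomorphicE u v : order_isomorphic u v = oiso u v.
Proof.
apply/idP/oisoP => [/andP[/eqP e /forallP H]|[e H]].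
  split=> // a b la lb.
  by move/forallP: (H (Ordinal la)) => /(_ (Ordinal lb))/eqP.
apply/andP; split; first exact/eqP.
by apply/forallP => a; apply/forallP => b; rewrite H.
Qed.

Lemma oiso_map_mono (f : nat -> nat) u v :
  {in u &, {mono f : x y / x < y}} -> oiso (map f u) v = oiso u v.
Proof.
move=> mf; apply/oisoP/oisoP; rewrite size_map => -[e H]; split=> // a b la lb.
  by rewrite -H // !(nth_map 0) // mf ?mem_nth.
by rewrite -H // !(nth_map 0) // mf ?mem_nth.
Qed.

Lemma oiso_map_anti (f g : nat -> nat) u v :
  {in u &, {mono f : x y /~ x < y}} -> {in v &, {mono g : x y /~ x < y}} ->
  oiso (map f u) (map g v) = oiso u v.
Proof.
move=> mf mg; apply/oisoP/oisoP; rewrite !size_map => -[e H]; split=> // a b la lb.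
  have := H b a lb la.
  by rewrite !(nth_map 0) -?e // mf ?mem_nth // mg ?mem_nth -?e.
by rewrite !(nth_map 0) -?e // mf ?mem_nth // mg ?mem_nth -?e // H.
Qed.

Lemma occurs_at_map (f : nat -> nat) om u :
  {in u &, {mono f : x y / x < y}} -> occurs_at om (map f u) = occurs_at om u.
Proof.
move=> mf; rewrite /occurs_at -map_drop has_map; apply: eq_in_has => d du /=.
rewrite -map_take -map_rcons oiso_map_mono // => x y; rewrite !mem_rcons !inE.
by move=> /predU1P[->|/mem_take xu] /predU1P[->|/mem_take yu];
  apply: mf => //; apply: mem_drop du.
Qed.

Lemma avoids_map (f : nat -> nat) om u :
  {in u &, {mono f : x y / x < y}} -> avoids om (map f u) = avoids om u.
Proof.
elim: u => //= x u IH mf; rewrite -map_cons occurs_at_map // IH // => y z yu zu.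
by apply: mf; rewrite inE ?yu ?zu orbT.
Qed.

Lemma wdes_map (f : nat -> nat) u :
  {in u &, {mono f : x y / x < y}} -> wdes (map f u) = wdes u.
Proof.
elim: u => //= x u IH mf; rewrite IH => [|y z yu zu]; last first.
  by apply: mf; rewrite inE ?yu ?zu orbT.
by case: u mf {IH} => //= y u ->//; rewrite !inE eqxx ?orbT.
Qed.

Lemma avoidsP om u :
  reflect (forall i, i < size u -> ~~ occurs_at om (drop i u)) (avoids om u).
Proof.
elim: u => [|x u IH]; first by constructor.
apply: (iffP andP) => [[nx /IH H] [|i] //|H]; first exact: H.
split; first exact: (H 0).
by apply/IH => i; apply: (H i.+1).
Qed.

(** * Permutations as words *)

Definition word n (p : 'S_n) : seq nat := [seq val (p i) | i : 'I_n].

Lemma oneline_word n (p : 'S_n) : oneline p = map succn (word p).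
Proof. by rewrite /oneline /word -map_comp. Qed.

Lemma size_word n (p : 'S_n) : size (word p) = n.
Proof. by rewrite size_map size_enum_ord. Qed.

Lemma size_oneline n (p : 'S_n) : size (oneline p) = n.
Proof. by rewrite size_map size_enum_ord. Qed.

Lemma word_inj n : injective (@word n).
Proof.
move=> p q /eq_in_map e; apply/permP => i; apply: val_inj.
by apply: e; rewrite mem_enum.
Qed.

Lemma oneline_inj n : injective (@oneline n).
Proof. by move=> p q; rewrite !oneline_word => /(inj_map succn_inj)/word_inj. Qed.

Lemma word_perm n (p : 'S_n) : perm_eq (word p) (iota 0 n).
Proof.
have u : uniq (word p).
  by rewrite map_inj_uniq ?enum_uniq // => i j /val_inj/perm_inj.
apply: uniq_perm => //; first exact: iota_uniq.
apply: (uniq_min_size u _ _).2; last by rewrite size_iota size_word.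
by move=> x /mapP[i _ ->]; rewrite mem_iota add0n ltn_ord.
Qed.

(** Injectivity and the common cardinality [n]! give surjectivity, so no permutation has to be
    rebuilt from its word. *)
Lemma words_perm n :
  perm_eq [seq word p | p : 'S_n] (permutations (iota 0 n)).
Proof.
have u : uniq [seq word p | p : 'S_n].
  by rewrite map_inj_uniq ?enum_uniq //; apply: word_inj.
apply: uniq_perm => //; first exact: permutations_uniq.
apply: (uniq_min_size u _ _).2.
  by move=> w /mapP[p _ ->]; rewrite mem_permutations word_perm.
by rewrite size_permutations ?iota_uniq // size_iota size_map -cardE card_Sn.
Qed.

Lemma onelines_perm n :
  perm_eq [seq oneline p | p : 'S_n] (permutations (iota 1 n)).
Proof.
have u : uniq [seq oneline p | p : 'S_n].
  by rewrite map_inj_uniq ?enum_uniq //; apply: oneline_inj.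
apply: uniq_perm => //; first exact: permutations_uniq.
apply: (uniq_min_size u _ _).2.
  move=> w /mapP[p _ ->]; rewrite mem_permutations oneline_word.
  by rewrite (iotaDl 1 0) perm_map // word_perm.
by rewrite size_permutations ?iota_uniq // size_iota size_map -cardE card_Sn.
Qed.

Lemma wdes_count (u : seq nat) :
  wdes u = count (fun i => nth 0 u i.+1 < nth 0 u i) (iota 0 (size u).-1).
Proof.
elim: u => //= x [|y u] // ->.
by rewrite [in RHS]/= -[in RHS](addn0 1) iotaDl count_map; congr (_ + _).
Qed.

Lemma des_wdes n (p : 'S_n) : des p = wdes (oneline p).
Proof.
rewrite wdes_count size_oneline /des -val_enum_ord count_map cardsE cardE size_filter.
by rewrite enumT; apply: eq_count => i.
Qed.

Lemma take_drop_nth k i (u : seq nat) : i + k <= size u ->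
  take k (drop i u) = [seq nth 0 u (i + a) | a <- iota 0 k].
Proof.
move=> lu; have sk : size (take k (drop i u)) = k.
  by rewrite size_takel // size_drop; lia.
apply: (@eq_from_nth _ 0) => [|a]; rewrite sk ?size_map ?size_iota // => la.
by rewrite (nth_map 0) ?size_iota // nth_iota // nth_take // nth_drop.
Qed.

Lemma qc_avoidsE k n (w : 'S_k) (p : 'S_n) :
  1 < k -> qc_avoids w p = avoids (oneline w) (oneline p).
Proof.
case: k w => [|[|k]] // w _.
set u := oneline p; have su : size u = n by exact: size_oneline.
rewrite /qc_avoids; apply/idP/avoidsP => [/existsPn H i|H].
  rewrite su => li; apply/hasPn => d; rewrite size_oneline drop_drop => /(nthP 0)[j].
  rewrite size_drop su nth_drop /= => lj <-.
  (* A letter at index [j] after the window sits at position [k.+1 + i + j] of the whole word. *)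
  have lj' : k.+1 + i + j < n by lia.
  move/existsPn: (H (Ordinal li)) => /(_ (Ordinal lj')).
  rewrite /qc_occurrence order_isomorphicE negb_and /= => /orP[|]; first by lia.
  by rewrite take_drop_nth // su; lia.
apply/existsPn => i; apply/existsPn => j; apply/negP => /andP[lij].
rewrite /= in lij; have lj := ltn_ord j.
rewrite order_isomorphicE -(@take_drop_nth k.+1) -/u; last by rewrite su; lia.
move=> o; have := H i; rewrite su ltn_ord => /(_ isT)/negP; apply.
apply/hasP; exists (nth 0 u j); last by rewrite size_oneline.
rewrite size_oneline drop_drop /=.
have -> : nth 0 u j = nth 0 (drop (k.+1 + i) u) (j - (k.+1 + i)).
  by rewrite nth_drop; congr (nth _ _ _); lia.
by apply: mem_nth; rewrite size_drop su; lia.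
Qed.

Lemma card_qc_avoids k n (w : 'S_k) m : 1 < k ->
  #|[set p : 'S_n | qc_avoids w p && (des p == m)]| = num_avoiders (oneline w) n m.
Proof.
move=> k1; rewrite /num_avoiders -(seq.permP (words_perm n)) count_map cardsE cardE size_filter.
rewrite enumT; apply: eq_count => p /=.
rewrite -[LHS]/(qc_avoids w p && (des p == m)) qc_avoidsE // des_wdes.
by rewrite (oneline_word p) avoids_map ?wdes_map.
Qed.

Definition word_Wilf_equiv (om om' : seq nat) : Prop :=
  forall n m, num_avoiders om n m = num_avoiders om' n m.

(** An involution that only rearranges letters permutes the words of [permutations (iota 0 n)],
    hence transports the count. *)
Lemma bij_word_Wilf_equiv (f : seq nat -> seq nat) om om' :
  (forall u, uniq u -> [/\ perm_eq (f u) u, f (f u) = u, wdes (f u) = wdes u &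
                        avoids om' (f u) = avoids om u]) ->
  word_Wilf_equiv om om'.
Proof.
move=> H n m; rewrite /num_avoiders; set S := permutations _.
have uS u : u \in S -> uniq u.
  by rewrite mem_permutations => /perm_uniq ->; apply: iota_uniq.
have fS u : u \in S -> f u \in S.
  move=> uu; have [p _ _ _] := H u (uS _ uu).
  by move: uu; rewrite !mem_permutations; apply: perm_trans.
have ufS : uniq (map f S).
  rewrite map_inj_in_uniq ?permutations_uniq // => u v /uS uu /uS uv e.
  by have [_ <- _ _] := H u uu; have [_ <- _ _] := H v uv; rewrite e.
have pS : perm_eq (map f S) S.
  apply: uniq_perm => //; first exact: permutations_uniq.
  apply: (uniq_min_size ufS _ _).2; last by rewrite size_map.
  by move=> v /mapP[u uu ->]; apply: fS.
rewrite -[RHS](seq.permP pS) count_map; apply: eq_in_count => u /uS uu /=.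
by have [_ _ -> ->] := H u uu.
Qed.

(** * Complementation *)

Definition compl n (u : seq nat) : seq nat := [seq n - x | x <- u].

Lemma wdes_anti (f : nat -> nat) (u : seq nat) : uniq u ->
  {in u &, {mono f : x y /~ x < y}} -> wdes (map f u) + wdes u = (size u).-1.
Proof.
elim: u => //= x u IH /andP[xu uu] mf.
have {}IH := IH uu (fun y z yu zu => mf y z (mem_behead (yu : y \in behead (x :: u)))
  (mem_behead (zu : z \in behead (x :: u)))).
case: u xu uu mf IH => //= y u; rewrite inE negb_or => /andP[xy _] _ mf IH.
rewrite mf ?inE ?eqxx ?orbT //; move: IH => /=; lia.
Qed.

Lemma compl_anti n u : all (fun x => x <= n) u ->
  {in u &, {mono (fun x => n - x) : x y /~ x < y}}.
Proof. by move=> /allP H x y /H lx /H ly /=; lia. Qed.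

Lemma occurs_at_anti (f g : nat -> nat) om u :
  {in u &, {mono f : x y /~ x < y}} -> {in om &, {mono g : x y /~ x < y}} ->
  occurs_at (map g om) (map f u) = occurs_at om u.
Proof.
move=> mf mg; rewrite /occurs_at size_map -map_drop has_map.
apply: eq_in_has => d du /=; rewrite -map_take -map_rcons oiso_map_anti // => y z.
by rewrite !mem_rcons !inE => /predU1P[->|/mem_take yu] /predU1P[->|/mem_take zu];
  apply: mf => //; apply: mem_drop du.
Qed.

Lemma avoids_anti (f g : nat -> nat) om u :
  {in u &, {mono f : x y /~ x < y}} -> {in om &, {mono g : x y /~ x < y}} ->
  avoids (map g om) (map f u) = avoids om u.
Proof.
move=> mf mg; elim: u mf => //= x u IH mf; rewrite IH; last first.
  by move=> y z yu zu; apply: mf; rewrite inE ?yu ?zu orbT.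
by rewrite -map_cons occurs_at_anti.
Qed.

(** Complementing turns descents into ascents. The case [m > n.-1] is separate because the truncated
    difference [n.-1 - m] would then count words without descents. *)
Lemma num_avoiders_compl N om n m : all (fun x => x <= N) om ->
  num_avoiders (compl N om) n m = if m <= n.-1 then num_avoiders om n (n.-1 - m) else 0.
Proof.
move=> omN; rewrite /num_avoiders; set S := permutations _.
have sS u : u \in S -> uniq u /\ size u = n.
  by rewrite mem_permutations => p; rewrite (perm_uniq p) (perm_size p) iota_uniq size_iota.
have lS u : u \in S -> all (fun x => x <= n.-1) u.
  rewrite mem_permutations => /perm_mem p.
  by apply/allP => x; rewrite p mem_iota /=; lia.
have ufS : uniq (map (compl n.-1) S).
  rewrite map_inj_in_uniq ?permutations_uniq // => u v /lS lu /lS lv.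
  have K w : all (fun x => x <= n.-1) w -> compl n.-1 (compl n.-1 w) = w.
    move=> /allP lw; rewrite /compl -map_comp; apply: map_id_in => x /lw /=; lia.
  by move=> /(congr1 (compl n.-1)); rewrite !K.
have pS : perm_eq (map (compl n.-1) S) S.
  apply: uniq_perm => //; first exact: permutations_uniq.
  apply: (uniq_min_size ufS _ _).2; last by rewrite size_map.
  move=> v /mapP[u uu ->].
  have [uu' su] := sS _ uu; have lu := lS _ uu.
  rewrite mem_permutations.
  have uc : uniq (compl n.-1 u).
    by rewrite map_inj_in_uniq // => x y /(allP lu) lx /(allP lu) ly; lia.
  apply: uniq_perm => //; first exact: iota_uniq.
  apply: (uniq_min_size uc _ _).2; last by rewrite size_iota size_map su.
  move=> x /mapP[y yu ->]; move/allP/(_ _ yu): lu.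
  by rewrite mem_iota -su; case: (u) yu => //= *; lia.
rewrite -(seq.permP pS) count_map.
case: ifP => lm; last first.
  rewrite -(count_pred0 S); apply: eq_in_count => u uS /=.
  have [uu su] := sS _ uS; have := wdes_anti uu (compl_anti (lS _ uS)).
  by rewrite -/(compl _ _) su => e; apply/negP => /andP[_ /eqP]; lia.
apply: eq_in_count => u uS /=.
have [uu su] := sS _ uS; have := wdes_anti uu (compl_anti (lS _ uS)).
rewrite /compl avoids_anti; [|exact: compl_anti (lS _ uS)|exact: compl_anti].
rewrite su => e; congr (_ && _); lia.
Qed.

Lemma word_Wilf_equiv_compl N om om' :
  all (fun x => x <= N) om -> all (fun x => x <= N) om' ->
  word_Wilf_equiv om om' -> word_Wilf_equiv (compl N om) (compl N om').
Proof. by move=> l l' e n m; rewrite !num_avoiders_compl // e. Qed.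

(** * Reverse-complementing blocks *)

Lemma wdes_rev (u : seq nat) : uniq u -> wdes (rev u) + wdes u = (size u).-1.
Proof.
move=> uu; rewrite !wdes_count size_rev.
have -> : count (fun i => nth 0 (rev u) i.+1 < nth 0 (rev u) i) (iota 0 (size u).-1) =
          count (fun i => nth 0 u i < nth 0 u i.+1) (iota 0 (size u).-1).
  (* Reversal sends the adjacent pair starting at [i] to the one starting at [(size u).-2 - i]. *)
  set I := iota _ _; set g := fun i => (size u).-2 - i.
  have pI : perm_eq (map g I) I.
    have ug : uniq (map g I).
      rewrite map_inj_in_uniq ?iota_uniq // => x y; rewrite !mem_iota /g; lia.
    apply: uniq_perm => //; first exact: iota_uniq.
    apply: (uniq_min_size ug _ _).2; last by rewrite size_map.
    by move=> x /mapP[y]; rewrite !mem_iota /g => ? ->; lia.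
  rewrite -[LHS](seq.permP pI) count_map; apply: eq_in_count => i.
  rewrite mem_iota /g /= => li; rewrite !nth_rev; try lia.
  by congr (nth _ _ _ < nth _ _ _); lia.
rewrite -[RHS](size_iota 0) -(count_predC (fun i => nth 0 u i < nth 0 u i.+1) (iota 0 _)).
congr (_ + _); apply: eq_in_count => i; rewrite mem_iota /= => li.
have li1 : i.+1 < size u by lia.
by have := nth_uniq 0 (ltnW li1) li1 uu; rewrite /=; lia.
Qed.

(** The order-reversing involution of the letters of [u]: the k-th smallest goes to the k-th
    largest. Unlike [compl], it keeps the set of letters of a block. *)
Definition mirror (u : seq nat) (x : nat) : nat :=
  nth 0 (sort leq u) (size u - (index x (sort leq u)).+1).

Lemma mirror_mem (u : seq nat) (x : nat) : x \in u -> mirror u x \in u.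
Proof.
move=> xu; rewrite /mirror -(mem_sort leq); apply: mem_nth.
by rewrite size_sort; case: (u) xu => //= *; lia.
Qed.

Lemma mirrorK (u : seq nat) (x : nat) : uniq u -> x \in u -> mirror u (mirror u x) = x.
Proof.
move=> uu xu; rewrite /mirror; set s := sort leq u.
have ss : size s = size u by rewrite size_sort.
have lx : index x s < size s by rewrite index_mem mem_sort.
have lk : size u - (index x s).+1 < size s by move: lx; rewrite ss /=; lia.
rewrite index_uniq ?sort_uniq //.
have -> : size u - (size u - (index x s).+1).+1 = index x s by move: lx; rewrite ss /=; lia.
by rewrite nth_index // mem_sort.
Qed.

Lemma mirror_anti (u : seq nat) : uniq u -> {in u &, {mono mirror u : x y /~ x < y}}.
Proof.
move=> uu; have ss : sorted ltn (sort leq u).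
  by rewrite ltn_sorted_uniq_leq sort_uniq uu sort_sorted //; exact: leq_total.
have us : uniq (sort leq u) by rewrite sort_uniq.
have lt_nth i j : i < size u -> j < size u ->
    (nth 0 (sort leq u) i < nth 0 (sort leq u) j) = (i < j).
  have H := sorted_ltn_nth ltn_trans 0 ss; move=> li lj.
  have Hi : i \in [pred k | k < size (sort leq u)] by rewrite inE size_sort.
  have Hj : j \in [pred k | k < size (sort leq u)] by rewrite inE size_sort.
  case: (ltngtP i j) => [/(H _ _ Hi Hj) //|/(H _ _ Hj Hi) /ltnW|->]; last exact: ltnn.
  by rewrite leqNgt => /negbTE.
move=> x y xu yu; rewrite /mirror.
have lx : index x (sort leq u) < size u by rewrite -(size_sort leq) index_mem mem_sort.
have ly : index y (sort leq u) < size u by rewrite -(size_sort leq) index_mem mem_sort.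
rewrite lt_nth; [|lia|lia].
rewrite -[in RHS](nth_index 0 (_ : x \in sort leq u)) ?mem_sort //.
rewrite -[in RHS](nth_index 0 (_ : y \in sort leq u)) ?mem_sort //.
by rewrite lt_nth //; lia.
Qed.

Definition revcomp (u : seq nat) : seq nat := map (mirror u) (rev u).

Lemma size_revcomp (u : seq nat) : size (revcomp u) = size u.
Proof. by rewrite size_map size_rev. Qed.

Lemma revcomp_perm (u : seq nat) : uniq u -> perm_eq (revcomp u) u.
Proof.
move=> uu; have ur : uniq (revcomp u).
  rewrite map_inj_in_uniq ?rev_uniq // => x y; rewrite !mem_rev => xu yu.
  by move=> e; rewrite -(mirrorK uu xu) e mirrorK.
apply: uniq_perm => //; apply: (uniq_min_size ur _ _).2.
  by move=> x /mapP[y]; rewrite mem_rev => yu ->; apply: mirror_mem.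
by rewrite size_revcomp.
Qed.

Lemma revcompK (u : seq nat) : uniq u -> revcomp (revcomp u) = u.
Proof.
move=> uu; have p := revcomp_perm uu; rewrite {1}/revcomp /mirror.
(* The sorted list depends only on the letters, so [u] and [revcomp u] have the same [mirror]. *)
have -> : sort leq (revcomp u) = sort leq u.
  by apply/perm_sortP => //; [exact: leq_total|exact: leq_trans|exact: anti_leq].
rewrite size_revcomp -/(mirror u) /revcomp -map_rev revK -map_comp.
by apply: map_id_in => x xu; apply: mirrorK.
Qed.

(** Reversing the positions and reversing the values each exchange descents with ascents. *)
Lemma wdes_revcomp (u : seq nat) : uniq u -> wdes (revcomp u) = wdes u.
Proof.
move=> uu; have := wdes_rev uu.
have ur : uniq (rev u) by rewrite rev_uniq.
have /(wdes_anti ur) : {in rev u &, {mono mirror u : x y /~ x < y}}.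
  by move=> x y; rewrite !mem_rev; apply: mirror_anti.
by rewrite size_rev -/(revcomp u); lia.
Qed.

Fixpoint avoids3 (P : nat -> nat -> nat -> bool) (u : seq nat) : bool :=
  if u is x :: v then
    ~~ (if v is y :: z :: _ then P x y z else false) && avoids3 P v
  else true.

Lemma avoids3P P (u : seq nat) :
  reflect (forall i, i.+2 < size u -> ~~ P (nth 0 u i) (nth 0 u i.+1) (nth 0 u i.+2))
          (avoids3 P u).
Proof.
elim: u => [|x u IH]; first by constructor.
apply: (iffP andP) => [[nx /IH H] [|i] li|H]; last split.
- by case: u nx li {IH H} => [|y [|z u]].
- exact: H.
- by case: u H {IH} => [|y [|z u]] // /(_ 0); apply.
- by apply/IH => i; apply: (H i.+1).
Qed.

Lemma avoids3_revcomp P Q (u : seq nat) : uniq u ->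
  (forall f, {in u &, {mono f : x y /~ x < y}} -> {in u & &, forall x y z,
     P (f z) (f y) (f x) = Q x y z}) ->
  avoids3 P (revcomp u) = avoids3 Q u.
Proof.
move=> uu PQ.
(* The triple at [i] of [revcomp u] is the mirrored triple at [size u - i.+3] of [u], read
   backwards. *)
have E i : i.+2 < size u ->
    P (nth 0 (revcomp u) i) (nth 0 (revcomp u) i.+1) (nth 0 (revcomp u) i.+2) =
    Q (nth 0 u (size u - i.+3)) (nth 0 u (size u - i.+2)) (nth 0 u (size u - i.+1)).
  move=> li; rewrite !(nth_map 0) ?size_rev; try lia.
  rewrite !nth_rev; try lia.
  by apply: PQ; [exact: mirror_anti|..]; apply: mem_nth => /=; lia.
apply/avoids3P/avoids3P; rewrite size_revcomp => H i li.
  have := H (size u - i.+3); rewrite E; last by lia.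
  have -> : size u - (size u - i.+3).+3 = i by lia.
  have -> : size u - (size u - i.+3).+2 = i.+1 by lia.
  have -> : size u - (size u - i.+3).+1 = i.+2 by lia.
  apply; lia.
have := H (size u - i.+3); rewrite E //.
have -> : (size u - i.+3).+1 = size u - i.+2 by lia.
have -> : (size u - i.+2).+1 = size u - i.+1 by lia.
apply; lia.
Qed.

Definition top_pattern (P : nat -> nat -> nat -> bool) (om : seq nat) : Prop :=
  size om = 4 /\ forall x y z d,
    oiso [:: x; y; z; d] om = P x y z && (maxn x (maxn y z) < d).

Lemma occurs_at_top P om x y z v : top_pattern P om ->
  occurs_at om [:: x, y, z & v] = P x y z && has (fun d => maxn x (maxn y z) < d) v.
Proof.
move=> [s4 oE]; rewrite /occurs_at s4 /= take0 drop0.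
have -> : has (fun d => oiso (rcons [:: x; y; z] d) om) v =
          has (fun d => P x y z && (maxn x (maxn y z) < d)) v.
  by apply: eq_has => d; rewrite -oE.
by elim: v => [|d v] /=; [rewrite andbF|move=> ->; rewrite -andb_orr].
Qed.

(** Any triple of [L] satisfying [P] is completed to an occurrence by [M], whereas a window
    containing [M] has no larger letter after it. So [L] has to avoid [P] consecutively, and [R] is
    independent of [L]. *)
Lemma avoids_top P om L M R : top_pattern P om ->
  all (fun x => x < M) L -> all (fun x => x < M) R ->
  avoids om (L ++ M :: R) = avoids3 P L && avoids om R.
Proof.
move=> tp lL lR; have [s4 _] := tp.
have nR m v : M <= m -> all (fun x => x < M) v -> has (fun d => m < d) v = false.
  by move=> Mm /allP lv; apply/hasP => -[d /lv]; lia.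
elim: L lL => [|x L IH] /=.
  case: R lR {nR} (nR) => [|y [|z v]] lR nR _; rewrite ?(occurs_at_top _ _ _ _ tp) ?nR ?andbF //.
  - by rewrite /occurs_at s4.
  - by rewrite /occurs_at s4.
  - lia.
  - by case/and3P: lR.
case/andP=> lx lL; rewrite IH // andbA; congr (_ && _).
case: L lL {IH} => [|y [|z L]] lL //=; rewrite ?andbT.
- case: R lR => [|z v] /=; first by rewrite /occurs_at s4.
  case/andP=> lz lv; rewrite (occurs_at_top _ _ _ _ tp) nR ?andbF //; lia.
- rewrite (occurs_at_top _ _ _ _ tp) nR ?andbF //; lia.
congr (~~ _ && _); rewrite (occurs_at_top _ _ _ _ tp).
suff -> : has (fun d => maxn x (maxn y z) < d) (L ++ M :: R) by rewrite andbT.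
apply/hasP; exists M; first by rewrite mem_cat inE eqxx orbT.
by case/and3P: lL => ly lz _; lia.
Qed.

(** Entering the maximum is never a descent, and leaving it always is one. *)
Lemma wdes_top L M R : all (fun x => x < M) L -> all (fun x => x < M) R ->
  wdes (L ++ M :: R) = wdes L + (R != [::]) + wdes R.
Proof.
elim: L => [_|x L IH /= /andP[lx lL] lR]; last first.
  by rewrite IH //; case: L lL {IH} => [|y L] //=; lia.
by case: R => //= y R /andP[-> _].
Qed.

Definition maxw (u : seq nat) : nat := \max_(x <- u) x.

Lemma maxw_mem (u : seq nat) : u != [::] -> maxw u \in u.
Proof.
rewrite /maxw; elim: u => // x [|y u] IH _; first by rewrite big_seq1 inE.
rewrite big_cons inE; have := IH isT; set m := \max_(_ <- _) _ => mu.
by case: (leqP x m) => _; rewrite ?mu ?eqxx ?orbT.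
Qed.

Lemma maxw_max (u : seq nat) (x : nat) : x \in u -> x <= maxw u.
Proof. by move=> xu; apply: leq_bigmax_seq. Qed.

(* Reverse-complements each block between consecutive right-to-left maxima
   within its own set of letters; k bounds the length of u. *)
Fixpoint block_revcomp k (u : seq nat) : seq nat :=
  if k is k'.+1 then
    if u is [::] then [::] else
      revcomp (take (index (maxw u) u) u) ++
        maxw u :: block_revcomp k' (drop (index (maxw u) u).+1 u)
  else [::].

Lemma block_revcomp_cat k L M R : M \notin L -> maxw (L ++ M :: R) = M ->
  block_revcomp k.+1 (L ++ M :: R) = revcomp L ++ M :: block_revcomp k R.
Proof.
move=> ML mM /=; rewrite mM.
have -> : index M (L ++ M :: R) = size L by rewrite index_cat (negbTE ML) /= eqxx addn0.
rewrite take_size_cat // drop_cat ltnNge leqnSn /= subSnn /= drop0.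
by case: L {ML mM}.
Qed.

(** Cut at the maximum [M]: the left block is rearranged within its own letters and the right part
    is treated by induction. The maximum stays in place, so a second application cuts at the same
    point, and [avoids_top] and [wdes_top] compare the two words piecewise. *)
Lemma block_revcompP (P Q : nat -> nat -> nat -> bool) om om' k (u : seq nat) :
  (forall f (v : seq nat), {in v &, {mono f : x y /~ x < y}} ->
     {in v & &, forall x y z, P (f z) (f y) (f x) = Q x y z}) ->
  top_pattern P om' -> top_pattern Q om -> uniq u -> size u <= k ->
  let f := block_revcomp k in
  [/\ perm_eq (f u) u, f (f u) = u, wdes (f u) = wdes u & avoids om' (f u) = avoids om u].
Proof.
move=> PQ tP tQ; elim: k u => [|k IH] u uu; first by case: u uu.
case: (u =P [::]) => [->|/eqP un0] su f; first by [].
have [L [R [M [uE mM ML MR]]]] : exists L R M,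
    [/\ u = L ++ M :: R, maxw u = M, M \notin L & M \notin R].
  have mu := maxw_mem un0; exists (take (index (maxw u) u) u).
  exists (drop (index (maxw u) u).+1 u), (maxw u).
  have uE : u = take (index (maxw u) u) u ++ maxw u :: drop (index (maxw u) u).+1 u.
    by rewrite -{2}(nth_index 0 mu) -drop_nth ?index_mem // cat_take_drop.
  by split=> //; move: uu; rewrite {1}uE cat_uniq /= negb_or => /and3P[_ /andP[ML _] /andP[MR _]].
have lL : all (fun x => x < M) L.
  apply/allP => x xL; rewrite ltn_neqAle; apply/andP; split.
    by apply: contraNneq ML => <-.
  by rewrite -mM; apply: maxw_max; rewrite uE mem_cat xL.
have lR : all (fun x => x < M) R.
  apply/allP => x xR; rewrite ltn_neqAle; apply/andP; split.
    by apply: contraNneq MR => <-.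
  by rewrite -mM; apply: maxw_max; rewrite uE mem_cat inE xR !orbT.
move: uu su mM; rewrite {un0}uE {u} => uu su mM.
have [uL uR] : uniq L /\ uniq R.
  by move: uu; rewrite cat_uniq /= => /and3P[-> _ /andP[_ ->]].
have [|pR RK dR aR] := IH R uR.
  by move: su; rewrite size_cat /=; lia.
have pL := revcomp_perm uL.
have fE : f (L ++ M :: R) = revcomp L ++ M :: block_revcomp k R by exact: block_revcomp_cat.
have pf : perm_eq (f (L ++ M :: R)) (L ++ M :: R).
  by rewrite fE perm_cat // perm_cons.
have lL' : all (fun x => x < M) (revcomp L) by rewrite (perm_all _ pL).
have lR' : all (fun x => x < M) (block_revcomp k R) by rewrite (perm_all _ pR).
split=> //.
- rewrite fE /f block_revcomp_cat ?revcompK ?RK ?(perm_mem pL) //.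
  by rewrite -fE -[RHS]mM; apply: perm_big.
- rewrite fE !wdes_top // wdes_revcomp // dR; congr (_ + (_ : bool) + _).
  by rewrite -!size_eq0 (perm_size pR).
- rewrite fE (avoids_top tP) // (avoids_top tQ) // aR; congr (_ && _).
  exact: avoids3_revcomp uL (fun f => PQ f L).
Qed.

Lemma revcomp_word_Wilf_equiv (P Q : nat -> nat -> nat -> bool) om om' :
  (forall f (v : seq nat), {in v &, {mono f : x y /~ x < y}} ->
     {in v & &, forall x y z, P (f z) (f y) (f x) = Q x y z}) ->
  top_pattern P om' -> top_pattern Q om -> word_Wilf_equiv om om'.
Proof.
move=> PQ tP tQ; apply: (@bij_word_Wilf_equiv (fun u => block_revcomp (size u) u)) => u uu.
have [p fK d a] := block_revcompP PQ tP tQ uu (leqnn _).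
(* The image has the same length, so the second application runs with the same bound. *)
by rewrite (perm_size p); split.
Qed.

(** The reverse-complement of 312 is 231. *)
Lemma wilf_3124_2314 : word_Wilf_equiv [:: 3; 1; 2; 4] [:: 2; 3; 1; 4].
Proof.
apply: (@revcomp_word_Wilf_equiv (fun x y z => z < x < y) (fun x y z => y < z < x)).
- by move=> f v mf x y z xv yv zv; rewrite !mf // andbC.
- split=> // x y z d; rewrite /oiso /=; lia.
- split=> // x y z d; rewrite /oiso /=; lia.
Qed.

(** The reverse-complement of 213 is 132. *)
Lemma wilf_2134_1324 : word_Wilf_equiv [:: 2; 1; 3; 4] [:: 1; 3; 2; 4].
Proof.
apply: (@revcomp_word_Wilf_equiv (fun x y z => x < z < y) (fun x y z => y < x < z)).
- by move=> f v mf x y z xv yv zv; rewrite !mf // andbC.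
- split=> // x y z d; rewrite /oiso /=; lia.
- split=> // x y z d; rewrite /oiso /=; lia.
Qed.

(** * Codes *)

(** Prepends a letter of rank [x]; [bump x] makes room by raising the letters that are at least
    [x]. *)
Definition pushl (x : nat) (v : seq nat) : seq nat := x :: map (bump x) v.

Lemma ltn_bump x : {mono bump x : y z / y < z}.
Proof. by move=> y z; rewrite /bump; lia. Qed.

Lemma avoids_pushl om x v :
  avoids om (pushl x v) = ~~ occurs_at om (pushl x v) && avoids om v.
Proof. by rewrite /pushl [LHS]/= avoids_map // => y z _ _; apply: ltn_bump. Qed.

(** The bumped head lies below [x] exactly when the head did. For empty [v] the bound forces
    [x = 0], so the default head adds no descent. *)
Lemma wdes_pushl x v : x <= size v -> wdes (pushl x v) = (head 0 v < x) + wdes v.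
Proof.
move=> lx; rewrite /pushl [LHS]/= wdes_map => [|y z _ _]; last exact: ltn_bump.
by case: v lx => [|y v] /=; rewrite /bump; lia.
Qed.

Fixpoint ext (bad : pred (seq nat)) n v : seq (seq nat) :=
  if n is n'.+1 then
    flatten [seq ext bad n' (pushl x v) | x <- iota 0 (size v).+1 & ~~ bad (pushl x v)]
  else [:: v].

Lemma extS bad n v : ext bad n.+1 v =
  flatten [seq ext bad n (pushl x v) | x <- iota 0 (size v).+1 & ~~ bad (pushl x v)].
Proof. by []. Qed.

Lemma ext0S n v :
  ext pred0 n.+1 v = flatten [seq ext pred0 n (pushl x v) | x <- iota 0 (size v).+1].
Proof. by rewrite extS filter_predT. Qed.

(** Later pushes preserve the relative order of the older letters, so an occurrence persists:
    pruning at every step amounts to filtering at the end. *)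
Lemma ext_avoids om n v : [seq u <- ext pred0 n v | avoids om u] =
  if avoids om v then ext (occurs_at om) n v else [::].
Proof.
elim: n v => [|n IH] v; first by rewrite /=; case: ifP.
rewrite ext0S extS; elim: (iota 0 _) => [|x s IHs] /=; first by case: ifP.
rewrite filter_cat IH IHs avoids_pushl.
by case: (avoids om v); case: (occurs_at om _).
Qed.

Lemma size_pushl x v : size (pushl x v) = (size v).+1.
Proof. by rewrite /= size_map. Qed.

Lemma size_ext0 n v : size (ext pred0 n v) * (size v)`! = (n + size v)`!.
Proof.
elim: n v => [|n IH] v; first by rewrite mul1n.
rewrite ext0S size_flatten /shape -map_comp sumnE big_map big_distrl.
apply/eqP; rewrite -(eqn_pmul2l (ltn0Sn (size v))) big_distrr; apply/eqP.
transitivity (\sum_(x <- iota 0 (size v).+1) (n.+1 + size v)`!).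
  apply: eq_bigr => x _; have := IH (pushl x v).
  by rewrite size_pushl factS addnS addSn => <- /=; rewrite mulnCA.
by rewrite big_const_seq iter_addn_0 count_predT size_iota mulnC.
Qed.

(** The recursion of [ext] exposes its first push; this adds a push at the end instead. *)
Lemma mem_ext0_pushl n u x v : x <= size u ->
  u \in ext pred0 n v -> pushl x u \in ext pred0 n.+1 v.
Proof.
elim: n v => [|n IH] v lx.
  rewrite [ext _ _ _]/= inE => /eqP uv; rewrite ext0S; apply/flattenP.
  exists [:: pushl x v]; last by rewrite uv inE.
  by apply/mapP; exists x => //; rewrite mem_iota -uv.
rewrite !ext0S => /flattenP[_ /mapP[y yv ->] us]; apply/flattenP.
exists (ext pred0 n.+1 (pushl y v)); last exact: IH us.
by apply/mapP; exists y.
Qed.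

(** Deleting the first letter and closing the gap by [unbump] shows that every permutation is
    generated; the count from [size_ext0] then excludes repetitions and other words. *)
Lemma ext0_perm n : perm_eq (ext pred0 n [::]) (permutations (iota 0 n)).
Proof.
have sub : {subset permutations (iota 0 n) <= ext pred0 n [::]}.
  elim: n => [|n IH] u; rewrite mem_permutations => pu.
    by move: (perm_size pu); case: u {pu}.
  have uu : uniq u by rewrite (perm_uniq pu) iota_uniq.
  have mu x : x \in u -> x <= n by rewrite (perm_mem pu) mem_iota.
  have su : size u = n.+1 by rewrite (perm_size pu) size_iota.
  case: u su uu mu {pu} => // x u [su] /andP[xu uu] mu.
  have -> : x :: u = pushl x (map (unbump x) u).
    congr (_ :: _); rewrite -map_comp map_id_in // => y yu /=; apply: unbumpK.
    by rewrite inE; apply: contraNneq xu => <-.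
  apply: mem_ext0_pushl; first by rewrite size_map su mu ?inE ?eqxx.
  apply: IH; rewrite mem_permutations.
  have un : uniq (map (unbump x) u).
    rewrite map_inj_in_uniq // => y z yu zu.
    have yx : y != x by apply: contraNneq xu => <-.
    have zx : z != x by apply: contraNneq xu => <-.
    by rewrite /unbump; lia.
  apply: uniq_perm => //; first exact: iota_uniq.
  apply: (uniq_min_size un _ _).2; last by rewrite size_iota size_map su.
  move=> _ /mapP[y yu ->]; rewrite mem_iota /unbump.
  have yx : y != x by apply: contraNneq xu => <-.
  have := mu y; rewrite inE yu orbT => /(_ isT).
  have := mu x; rewrite inE eqxx => /(_ isT); lia.
have sz : size (ext pred0 n [::]) = size (permutations (iota 0 n)).
  have := size_ext0 n [::]; rewrite muln1 addn0 => ->.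
  by rewrite size_permutations ?iota_uniq ?size_iota.
have us := leq_size_uniq (permutations_uniq _) sub (eq_leq sz).
rewrite perm_sym; apply: uniq_perm => //; first exact: permutations_uniq.
exact: (uniq_min_size (permutations_uniq _) sub (eq_leq sz)).2.
Qed.

Lemma num_avoiders_ext om n m :
  num_avoiders om n m = count (fun u => wdes u == m) (ext (occurs_at om) n [::]).
Proof.
rewrite /num_avoiders -(seq.permP (ext0_perm n)).
have -> : ext (occurs_at om) n [::] = [seq u <- ext pred0 n [::] | avoids om u].
  by rewrite ext_avoids.
by rewrite count_filter; apply: eq_count => u; rewrite /= andbC.
Qed.

Lemma pushl_perm x u : x <= size u ->
  perm_eq u (iota 0 (size u)) -> perm_eq (pushl x u) (iota 0 (size u).+1).
Proof.
move=> lx pu; have uu : uniq u by rewrite (perm_uniq pu) iota_uniq.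
have up : uniq (pushl x u).
  rewrite /= map_inj_uniq ?uu ?andbT; last by move=> y z; rewrite /bump; lia.
  by apply/mapP => -[y _]; rewrite /bump; lia.
apply: uniq_perm => //; first exact: iota_uniq.
apply: (uniq_min_size up _ _).2; last by rewrite size_iota size_pushl.
move=> y; rewrite inE mem_iota => /predU1P[->|/mapP[z]]; first by lia.
by rewrite (perm_mem pu) mem_iota => lz ->; rewrite /bump; lia.
Qed.

(** The last letter of an occurrence may stand anywhere in [u], so only the set of letters of [u]
    matters, hence its length. *)
Lemma occurs_at3 om x y u : size om = 3 -> perm_eq u (iota 0 (size u)) ->
  occurs_at om (pushl x (pushl y u)) =
  has (fun d => oiso [:: x; bump x y; bump x (bump y d)] om) (iota 0 (size u)).
Proof.
move=> s3 pu; rewrite /occurs_at s3 /= take0 drop0 -map_comp has_map -(perm_has _ pu).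
exact: eq_has.
Qed.

Lemma occurs_at4 om x y z u : size om = 4 -> perm_eq u (iota 0 (size u)) ->
  occurs_at om (pushl x (pushl y (pushl z u))) =
  has (fun d => oiso [:: x; bump x y; bump x (bump y z); bump x (bump y (bump z d))] om)
      (iota 0 (size u)).
Proof.
move=> s4 pu; rewrite /occurs_at s4 /= take0 drop0 -!map_comp has_map -(perm_has _ pu).
exact: eq_has.
Qed.

(* s is the length of the word built so far, y and then z are the ranks of its
   first two letters, and c tells when a new first letter of rank x creates an
   occurrence of om. *)
Definition code3 (om : seq nat) (c : nat -> nat -> nat -> bool) : Prop :=
  size om = 3 /\ forall x y u, perm_eq u (iota 0 (size u)) ->
    y <= size u -> x <= (size u).+1 ->
    occurs_at om (pushl x (pushl y u)) = c (size u).+1 y x.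

Definition code4 (om : seq nat) (c : nat -> nat -> nat -> nat -> bool) : Prop :=
  size om = 4 /\ forall x y z u, perm_eq u (iota 0 (size u)) ->
    z <= size u -> y <= (size u).+1 -> x <= (size u).+2 ->
    occurs_at om (pushl x (pushl y (pushl z u))) = c (size u).+2 z y x.

(** Leaves only arithmetic: [q] is the order type of the pattern, and [w] gives the rank in [u] of a
    last letter completing an occurrence. *)
Lemma code3P om (q : nat -> nat -> nat -> bool) (c : nat -> nat -> nat -> bool)
    (w : nat -> nat -> nat) :
  size om = 3 -> (forall x y d, oiso [:: x; y; d] om = q x y d) ->
  (forall s y x d, y <= s -> x <= s.+1 -> d < s ->
     q x (bump x y) (bump x (bump y d)) -> c s.+1 y x) ->
  (forall s y x, y <= s -> x <= s.+1 -> c s.+1 y x ->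
     (w y x < s) && q x (bump x y) (bump x (bump y (w y x)))) ->
  code3 om c.
Proof.
move=> s3 qE H1 H2; split=> // x y u pu ly lx; rewrite occurs_at3 //.
apply/hasP/idP => [[d]|/(H2 _ _ _ ly lx)/andP[ld o]].
  by rewrite mem_iota qE => ld; apply: H1.
by exists (w y x); rewrite ?mem_iota ?qE.
Qed.

Lemma code4P om (q : nat -> nat -> nat -> nat -> bool) (c : nat -> nat -> nat -> nat -> bool)
    (w : nat -> nat -> nat -> nat -> nat) :
  size om = 4 -> (forall x y z d, oiso [:: x; y; z; d] om = q x y z d) ->
  (forall s z y x d, z <= s -> y <= s.+1 -> x <= s.+2 -> d < s ->
     q x (bump x y) (bump x (bump y z)) (bump x (bump y (bump z d))) -> c s.+2 z y x) ->
  (forall s z y x, z <= s -> y <= s.+1 -> x <= s.+2 -> c s.+2 z y x ->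
     (w s z y x < s) &&
     q x (bump x y) (bump x (bump y z)) (bump x (bump y (bump z (w s z y x))))) ->
  code4 om c.
Proof.
move=> s4 qE H1 H2; split=> // x y z u pu lz ly lx; rewrite occurs_at4 //.
apply/hasP/idP => [[d]|/(H2 _ _ _ _ lz ly lx)/andP[ld o]].
  by rewrite mem_iota qE => ld; apply: H1.
by exists (w (size u) z y x); rewrite ?mem_iota ?qE.
Qed.

(** If [x <= y], exactly [y - x] letters of [u] lie between the first two letters. *)
Lemma code_132 : code3 [:: 1; 3; 2] (fun s y x => x < y).
Proof.
apply: (@code3P _ (fun x y d => x < d < y) _ (fun y x => x)) => //.
- by move=> x y d; rewrite /oiso /=; lia.
- by move=> s y x d; rewrite /bump; lia.
- by move=> s y x; rewrite /bump; lia.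
Qed.

(** If [y < x], exactly [x - y.+1] letters of [u] lie between the first two letters. *)
Lemma code_312 : code3 [:: 3; 1; 2] (fun s y x => y.+1 < x).
Proof.
apply: (@code3P _ (fun x y d => y < d < x) _ (fun y x => y)) => //.
- by move=> x y d; rewrite /oiso /=; lia.
- by move=> s y x d; rewrite /bump; lia.
- by move=> s y x; rewrite /bump; lia.
Qed.

Lemma code_1342 : code4 [:: 1; 3; 4; 2] (fun s z y x => x < y <= z).
Proof.
apply: (@code4P _ (fun x y z d => [&& x < d, d < y & y < z]) _ (fun s z y x => x)) => //.
- by move=> x y z d; rewrite /oiso /=; lia.
- by move=> s z y x d; rewrite /bump; lia.
- by move=> s z y x; rewrite /bump; lia.
Qed.

Lemma code_1243 : code4 [:: 1; 2; 4; 3] (fun s z y x => x <= y < z).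
Proof.
apply: (@code4P _ (fun x y z d => [&& x < y, y < d & d < z]) _ (fun s z y x => y)) => //.
- by move=> x y z d; rewrite /oiso /=; lia.
- by move=> s z y x d; rewrite /bump; lia.
- by move=> s z y x; rewrite /bump; lia.
Qed.

(* A peak z < y >= x may take the values maxn x z.+1, ..., s.-1. *)
Definition top_peak (sel : rel nat) (s z y x : nat) : bool :=
  [&& z < y, x <= y, sel z x & y.+1 != s].

Definition low_peak (sel : rel nat) (s z y x : nat) : bool :=
  [&& z < y, x <= y, sel z x & y != maxn x z.+1].

Lemma code_1324 : code4 [:: 1; 3; 2; 4] (top_peak (fun z x => x <= z)).
Proof.
(* The witness is the largest letter of [u]: [y] has a larger letter to its right unless its rank is
   maximal. *)
apply: (@code4P _ (fun x y z d => [&& x < z, z < y & y < d]) _ (fun s z y x => s.-1)) => //.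
- by move=> x y z d; rewrite /oiso /=; lia.
- by move=> s z y x d; rewrite /bump /top_peak; lia.
- by move=> s z y x; rewrite /bump /top_peak; lia.
Qed.

Lemma code_1423 : code4 [:: 1; 4; 2; 3] (low_peak (fun z x => x <= z)).
Proof.
apply: (@code4P _ (fun x y z d => [&& x < z, z < d & d < y]) _ (fun s z y x => z)) => //.
- by move=> x y z d; rewrite /oiso /=; lia.
- by move=> s z y x d; rewrite /bump /low_peak; lia.
- by move=> s z y x; rewrite /bump /low_peak; lia.
Qed.

Lemma code_2314 : code4 [:: 2; 3; 1; 4] (top_peak (fun z x => z < x)).
Proof.
apply: (@code4P _ (fun x y z d => [&& z < x, x < y & y < d]) _ (fun s z y x => s.-1)) => //.
- by move=> x y z d; rewrite /oiso /=; lia.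
- by move=> s z y x d; rewrite /bump /top_peak; lia.
- by move=> s z y x; rewrite /bump /top_peak; lia.
Qed.

Lemma code_2413 : code4 [:: 2; 4; 1; 3] (low_peak (fun z x => z < x)).
Proof.
(* The witness is the letter just above [x]; its rank in [u] is [x.-1] because [z], which is
   smaller, is not in [u]. *)
apply: (@code4P _ (fun x y z d => [&& z < x, x < d & d < y]) _ (fun s z y x => x.-1)) => //.
- by move=> x y z d; rewrite /oiso /=; lia.
- by move=> s z y x d; rewrite /bump /low_peak; lia.
- by move=> s z y x; rewrite /bump /low_peak; lia.
Qed.

Import GRing.Theory.
Local Open Scope ring_scope.

(** * Generating functions by descents *)

Section Weight.
Variables (R : comNzRingType) (t : R).

(* Generating function by descents of the words obtained from v by n steps of
   pushl, not creating an occurrence of om; v itself contributes no factor. *)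
Fixpoint wt om n v : R :=
  if n is n'.+1 then
    \sum_(x < (size v).+1 | ~~ occurs_at om (pushl x v))
       t ^+ (head 0%N v < x)%N * wt om n' (pushl x v)
  else 1.

Lemma wt_ext om n v :
  \sum_(u <- ext (occurs_at om) n v) t ^+ wdes u = t ^+ wdes v * wt om n v.
Proof.
elim: n v => [|n IH] v; first by rewrite /= big_seq1 mulr1.
rewrite extS [wt _ _ _]/= big_flatten big_map big_filter mulr_sumr.
have -> : iota 0 (size v).+1 = index_iota 0 (size v).+1 by rewrite /index_iota subn0.
rewrite big_mkord; apply: eq_bigr => x _.
by rewrite IH (wdes_pushl (leq_ord x)) exprD mulrCA mulrA.
Qed.

End Weight.

Lemma wt_num_avoiders om n m : (wt ('X : {poly int}) om n [::])`_m = (num_avoiders om n m)%:R.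
Proof.
have := wt_ext ('X : {poly int}) om n [::]; rewrite expr0 mul1r => <-.
rewrite coef_sum num_avoiders_ext -sum1_count natr_sum [in RHS]big_mkcond.
by apply: eq_bigr => u _; rewrite coefXn eq_sym; case: eqP.
Qed.

(** Taking [t = 'X] over [int] makes the counts recoverable as coefficients. *)
Lemma wt_word_Wilf_equiv om om' :
  (forall n, wt ('X : {poly int}) om n [::] = wt ('X : {poly int}) om' n [::]) ->
  word_Wilf_equiv om om'.
Proof.
move=> e n m; have := wt_num_avoiders om n m; rewrite e wt_num_avoiders => /eqP.
by rewrite Num.Theory.eqr_nat => /eqP.
Qed.

Section CodeWeight.
Variables (R : comNzRingType) (t : R).

(** The transfer recurrence on codes: the possible continuations depend only on the length [s] and
    the latest rank [y]. *)
Fixpoint wt3 (c : nat -> nat -> nat -> bool) n s y : R :=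
  if n is n'.+1 then
    \sum_(x < s.+1 | ~~ c s y x) t ^+ (y < x)%N * wt3 c n' s.+1 x
  else 1.

Fixpoint wt4 (c : nat -> nat -> nat -> nat -> bool) n s z y : R :=
  if n is n'.+1 then
    \sum_(x < s.+1 | ~~ c s z y x) t ^+ (y < x)%N * wt4 c n' s.+1 y x
  else 1.

Lemma wtS om n v : wt t om n.+1 v =
  \sum_(x < (size v).+1 | ~~ occurs_at om (pushl x v))
     t ^+ (head 0%N v < x)%N * wt t om n (pushl x v).
Proof. by []. Qed.

Lemma wt_wt3 om c n : code3 om c -> wt t om n.+1 [::] = wt3 c n 1 0.
Proof.
move=> [s3 cE].
have H u y : perm_eq u (iota 0 (size u)) -> (y <= size u)%N ->
    wt t om n (pushl y u) = wt3 c n (size u).+1 y.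
  elim: n u y => // n IH u y pu ly.
  rewrite [wt3 _ _ _ _]/= wtS size_pushl; apply: eq_big => x; first by rewrite cE // leq_ord.
  by rewrite IH ?size_pushl ?leq_ord ?pushl_perm.
(* The first push has rank 0 and weight 1. *)
rewrite [LHS]/= big_mkcond big_ord1 /= {1}/occurs_at s3 /= mul1r.
exact: (H [::]).
Qed.

Lemma wt_wt4 om c n : code4 om c ->
  wt t om n.+2 [::] = \sum_(y < 2) t ^+ (0 < y)%N * wt4 c n 2 0 y.
Proof.
move=> [s4 cE].
have H u z y : perm_eq u (iota 0 (size u)) -> (z <= size u)%N -> (y <= (size u).+1)%N ->
    wt t om n (pushl y (pushl z u)) = wt4 c n (size u).+2 z y.
  elim: n u z y => // n IH u z y pu lz ly.
  rewrite [wt4 _ _ _ _ _]/= wtS !size_pushl; apply: eq_big => x; first by rewrite cE // leq_ord.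
  by rewrite IH ?size_pushl ?leq_ord ?pushl_perm.
rewrite [LHS]/= big_mkcond big_ord1 /= {1}/occurs_at s4 /= mul1r.
by apply: eq_big => y; rewrite ?{1}/occurs_at ?s4 //= => _; rewrite -(H [::]) // leq_ord.
Qed.

End CodeWeight.

Lemma code3_word_Wilf_equiv om c om' c' : code3 om c -> code3 om' c' ->
  (forall (R : comNzRingType) (t : R) n, wt3 t c n 1 0 = wt3 t c' n 1 0) -> word_Wilf_equiv om om'.
Proof.
move=> cE cE' e; apply: wt_word_Wilf_equiv => -[|n] //.
by rewrite (wt_wt3 _ _ cE) (wt_wt3 _ _ cE') e.
Qed.

Lemma code4_word_Wilf_equiv om c om' c' : code4 om c -> code4 om' c' ->
  (forall (R : comNzRingType) (t : R) n,
     \sum_(y < 2) t ^+ (0 < y)%N * wt4 t c n 2 0 y =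
     \sum_(y < 2) t ^+ (0 < y)%N * wt4 t c' n 2 0 y) -> word_Wilf_equiv om om'.
Proof.
move=> cE cE' e; apply: wt_word_Wilf_equiv => -[|[|n]] //; last first.
  by rewrite (wt_wt4 _ _ cE) (wt_wt4 _ _ cE'); exact: e.
case: cE cE' => s _ [s' _]; rewrite !wtS !(big_mkcond (fun _ => ~~ _)) !big_ord1 /=.
by rewrite /occurs_at s s'.
Qed.

(** * Weighted Motzkin paths and binomial transforms *)

Section Narayana.
Variable R : comNzRingType.

(** Pascal's rule in recursive form: the value is $\sum_d \binom{p}{d} H(d)$. *)
Fixpoint binomial_transform (H : nat -> R) p : R :=
  if p is p'.+1 then
    binomial_transform H p' + binomial_transform (fun d => H d.+1) p'
  else H 0%N.

(* Weight of the Motzkin paths of length n from height d to height 0, with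
   up-steps of weight a, down-steps of weight b and level steps of weight a + b. *)
Fixpoint motzkin (a b : R) n d : R :=
  if n is n'.+1 then
    (a + b) * motzkin a b n' d + a * motzkin a b n' d.+1 +
    b * (if d is d'.+1 then motzkin a b n' d' else 0)
  else (d == 0%N)%:R.

(** A path from height [d] to 0 has [d] more down-steps than up-steps, so its weight is $b^d$ times
    a factor symmetric in [a] and [b]. *)
Lemma motzkin_swap a b n d : b ^+ d * motzkin b a n d = a ^+ d * motzkin a b n d.
Proof.
elim: n d => [|n IH] d /=.
  by case: d => [|d] /=; rewrite ?mulr0.
have IHd := IH d; have IHS := IH d.+1; rewrite !exprS in IHS.
case: d IHd IHS => [|d] IHd IHS.
  rewrite !expr0 in IHd IHS *; rewrite !mulr1 in IHS; rewrite !mul1r in IHd *.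
  by rewrite IHd IHS; ring.
have IHp := IH d; rewrite !exprS in IHd IHS *.
transitivity ((b + a) * (b * b ^+ d * motzkin b a n d.+1) +
   b * (b * b ^+ d) * motzkin b a n d.+2 + a * b * (b ^+ d * motzkin b a n d)); first by ring.
rewrite IHd IHp.
have -> : b * (b * b ^+ d) * motzkin b a n d.+2 = a * (a * a ^+ d) * motzkin a b n d.+2 by [].
ring.
Qed.

Lemma eq_binomial_transform H H' p : (H =1 H') ->
  binomial_transform H p = binomial_transform H' p.
Proof.
elim: p H H' => [|p IH] H H' e /=; first exact: e.
by rewrite (IH H H') // (IH (fun d => H d.+1) (fun d => H' d.+1)).
Qed.

Lemma binomial_transform_lin a b H H' p :
  binomial_transform (fun d => a * H d + b * H' d) p =
  a * binomial_transform H p + b * binomial_transform H' p.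
Proof. by elim: p H H' => [|p IH] H H' //=; rewrite !IH; ring. Qed.

Lemma binomial_transform_motzkin0 a b p : binomial_transform (motzkin a b 0) p = 1.
Proof.
elim: p => //= p ->; rewrite (@eq_binomial_transform _ (fun d => 0 * 0 + 0 * 0)).
  by rewrite (binomial_transform_lin 0 0 (fun=> 0) (fun=> 0)) !mul0r !addr0.
by move=> d; rewrite !mul0r addr0.
Qed.

(** The level weight [a + b] is split. Its [a] part joins the up-steps by Pascal's rule; its [b]
    part joins the down-steps, whose transform is a sum over [k < p] by the hockey-stick
    identity. *)
Lemma binomial_transform_motzkinS a b n p :
  binomial_transform (motzkin a b n.+1) p =
  a * binomial_transform (motzkin a b n) p.+1 +
  b * \sum_(k < p.+1) binomial_transform (motzkin a b n) k.
Proof.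
set H := motzkin a b n; set H1 := fun d => H d.+1.
set H2 := fun d => if d is d'.+1 then H d' else 0.
rewrite (@eq_binomial_transform _ (fun d => 1 * (a * (1 * H d + 1 * H1 d)  + b * H d) + b * H2 d)).
  rewrite !binomial_transform_lin !mul1r big_ord_recr /= -/H -/H1.
  have -> : binomial_transform H2 p = \sum_(k < p) binomial_transform H k.
    elim: p => [|p IH]; first by rewrite big_ord0.
    rewrite big_ord_recr -IH /=; congr (_ + _); exact: eq_binomial_transform.
  ring.
by move=> d; rewrite /= -/H -/(H1 d) -/(H2 d); ring.
Qed.

Lemma sum_ltn_rev y s (F : nat -> R) : (y <= s)%N ->
  \sum_(x < s.+1 | (y < x)%N) F (s - x)%N = \sum_(k < s - y) F k.
Proof.
move=> ys; rewrite -(big_geq_mkord _ _ xpredT (fun x => F (s - x)%N)) big_nat_rev /=.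
rewrite -[X in \sum_(X <= _ < _) _](add0n y.+1) big_addn subSS big_mkord.
by apply: eq_bigr => k _; congr (F _); have := ltn_ord k; lia.
Qed.

End Narayana.

(** * The codes of 132 and 312 *)

Section LengthThree.
Variables (R : comNzRingType) (t : R).

Lemma sum_split s y (P : pred nat) (F : nat -> R) :
  \sum_(x < s | P x) t ^+ (y < x)%N * F x =
  \sum_(x < s | P x && (x <= y)%N) F x + t * \sum_(x < s | P x && (y < x)%N) F x.
Proof.
rewrite (bigID (fun x : 'I_s => (x <= y)%N)) /= mulr_sumr; congr (_ + _).
  by apply: eq_bigr => x /andP[_ lx]; rewrite ltnNge lx mul1r.
by apply: eq_big => x; [rewrite ltnNge|rewrite -ltnNge => /andP[_ ->]; rewrite expr1].
Qed.

(** The parameter [p = s.-1 - y] counts the larger letters. Repeating the rank has weight 1 and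
    leads to [p.+1]; a larger rank has weight [t] and leads to any value up to [p]. *)
Lemma wt3_132 n s y : (y < s)%N ->
  wt3 t (fun s y x => (x < y)%N) n s y = binomial_transform (motzkin 1 t n) (s.-1 - y).
Proof.
elim: n s y => [|n IH] s y ys; first by rewrite binomial_transform_motzkin0.
rewrite binomial_transform_motzkinS mul1r [LHS]/=.
rewrite (sum_split _ _ (fun x => ~~ (x < y)%N) (wt3 t _ n s.+1)); congr (_ + _ * _).
  rewrite (eq_bigl (fun x : 'I_s.+1 => (x : nat) == y)) => [|x]; last by lia.
  rewrite big_ord1_eq ltnS (ltnW ys) IH; last by lia.
  by congr (binomial_transform _ _); lia.
rewrite (eq_bigl (fun x : 'I_s.+1 => (y < x)%N)) => [|x]; last by lia.
have -> : (s.-1 - y).+1 = (s - y)%N by lia.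
rewrite -sum_ltn_rev; last by lia.
by apply: eq_bigr => x _; rewrite IH.
Qed.

(** With parameter [y], the rank [y.+1] has weight [t] and every rank up to [y] has weight 1: the
    same recurrence with the two weights exchanged. *)
Lemma wt3_312 n s y : (y < s)%N ->
  wt3 t (fun s y x => (y.+1 < x)%N) n s y = binomial_transform (motzkin t 1 n) y.
Proof.
elim: n s y => [|n IH] s y ys; first by rewrite binomial_transform_motzkin0.
rewrite binomial_transform_motzkinS mul1r [LHS]/=.
rewrite (sum_split _ _ (fun x => ~~ (y.+1 < x)%N) (wt3 t _ n s.+1)) addrC; congr (_ * _ + _).
  rewrite (eq_bigl (fun x : 'I_s.+1 => (x : nat) == y.+1)) => [|x]; last by lia.
  by rewrite big_ord1_eq ltnS ys IH.
rewrite (eq_bigl (fun x : 'I_s.+1 => (x < y.+1)%N)) => [|x]; last by lia.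
rewrite (big_ord_widen _ (fun k => binomial_transform (motzkin t 1 n) k)
  (ltnW ys : y.+1 <= s.+1)%N).
by apply: eq_bigr => x lx; rewrite IH //; lia.
Qed.

End LengthThree.

(** * Peaks forced to be largest or smallest *)

Section Peaks.
Variables (R : comNzRingType) (t : R) (sel : rel nat).

Let T := wt4 t (top_peak sel).
Let L := wt4 t (low_peak sel).

(* For given neighbours z and x of a peak, selected or not, the two rules leave
   equally many values for it. *)
Lemma sum_peak s z x (a : R) :
  \sum_(y < s.+1 | (z < y)%N && (~~ top_peak sel s.+1 z y x && (x <= y)%N)) a =
  \sum_(y < s.+1 | (z < y)%N && (~~ low_peak sel s.+1 z y x && (x <= y)%N)) a.
Proof.
rewrite /top_peak /low_peak; case sx: (sel z x); last by apply: eq_bigl => y; lia.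
case: (leqP (maxn x z.+1) s) => ms; last first.
  by rewrite !big_pred0 // => y; have := ltn_ord y; lia.
rewrite (eq_bigl (fun y : 'I_s.+1 => (y : nat) == s)) => [|y]; last first.
  by have := ltn_ord y; lia.
rewrite [RHS](eq_bigl (fun y : 'I_s.+1 => (y : nat) == maxn x z.+1)) => [|y]; last by lia.
by rewrite !(big_ord1_eq _ (fun=> a)) ltnSn ltnS ms.
Qed.

(** If [y <= z], then [y] cannot be a peak and [z] is irrelevant. If [z < y], the weights agree only
    after summation over [y]: ascending continuations match by induction, and in the others the tail
    depends only on [x], so [sum_peak] compares the numbers of peak values. *)
Lemma wt4_peak n :
  (forall s z z' y, (y < s)%N -> (y <= z)%N -> (y <= z')%N -> T n s z y = L n s z' y) /\
  (forall s z, (z < s)%N ->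
     \sum_(y < s.+1 | (z < y)%N) T n s.+1 z y = \sum_(y < s.+1 | (z < y)%N) L n s.+1 z y).
Proof.
elim: n => [|n [IHD IHS]]; first by [].
have up s y : (y < s)%N ->
    \sum_(x < s.+1 | (y < x)%N) T n s.+1 y x = \sum_(x < s.+1 | (y < x)%N) L n s.+1 y x.
  exact: IHS.
split=> [s z z' y ys yz yz'|s z zs]; rewrite /T /L /=.
  rewrite (sum_split _ _ _ (fun x => ~~ top_peak sel s z y x) (T n s.+1 y)).
  rewrite (sum_split _ _ _ (fun x => ~~ low_peak sel s z' y x) (L n s.+1 y)).
  congr (_ + t * _).
    apply: eq_big => [x|x /andP[_ xy]]; first by rewrite /top_peak /low_peak; lia.
    by apply: IHD => //; lia.
  transitivity (\sum_(x < s.+1 | (y < x)%N) T n s.+1 y x).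
    by apply: eq_bigl => x; rewrite /top_peak; lia.
  by rewrite up //; apply: eq_bigl => x; rewrite /low_peak; lia.
(* Any previous rank that is at least [x] gives the same tail; replacing [y] by [x] makes the tail
   independent of [y], so that the sums can be exchanged. *)
transitivity (\sum_(y < s.+1 | (z < y)%N)
   (\sum_(x < s.+2 | ~~ top_peak sel s.+1 z y x && (x <= y)%N) L n s.+2 x x +
    t * \sum_(x < s.+2 | (y < x)%N) L n s.+2 y x)).
  apply: eq_bigr => y _.
  rewrite (sum_split _ _ _ (fun x => ~~ top_peak sel s.+1 z y x) (T n s.+2 y)).
  congr (_ + t * _); first by apply: eq_bigr => x /andP[_ xy]; apply: IHD => //; lia.
  rewrite -IHS; last exact: ltn_ord.
  by apply: eq_bigl => x; rewrite /top_peak; lia.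
transitivity (\sum_(y < s.+1 | (z < y)%N)
   (\sum_(x < s.+2 | ~~ low_peak sel s.+1 z y x && (x <= y)%N) L n s.+2 x x +
    t * \sum_(x < s.+2 | (y < x)%N) L n s.+2 y x)); last first.
  apply: eq_bigr => y _.
  rewrite (sum_split _ _ _ (fun x => ~~ low_peak sel s.+1 z y x) (L n s.+2 y)).
  congr (_ + t * _).
    apply: eq_bigr => x /andP[_ xy]; rewrite -[LHS](IHD _ x) ?leqnn //.
    by apply: IHD => //; lia.
  by apply: eq_bigl => x; rewrite /low_peak; lia.
rewrite !big_split; congr (_ + _).
rewrite (exchange_big_dep xpredT) //= [RHS](exchange_big_dep xpredT) //=.
by apply: eq_bigr => x _; apply: sum_peak.
Qed.

End Peaks.

Lemma peak_word_Wilf_equiv om om' sel :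
  code4 om (top_peak sel) -> code4 om' (low_peak sel) -> word_Wilf_equiv om om'.
Proof.
move=> cE cE'; apply: code4_word_Wilf_equiv cE cE' _ => R t n; have [D S] := wt4_peak t sel n.
rewrite !big_ord_recl !big_ord0 /= (D 2 0 0 0)%N //; congr (_ + (_ * _ + _)).
(* Here the sum over [y] has the single term [y = 1]. *)
have := S 1%N 0%N isT; rewrite !(big_mkcond (fun _ => _ < _)%N) !big_ord_recl !big_ord0 /=.
by rewrite !add0r !addr0.
Qed.

(** * Weakly decreasing runs with two values *)

Section Runs.
Variables (R : comNzRingType) (t : R).

(* In a weakly decreasing run v1 >= v2 >= ... of a code, avoiding 1342 forces
   v2 = v3 = ..., while avoiding 1243 forces all letters but the last to be
   equal. The booleans say whether v is not the first letter of its run (eqtail)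
   and whether it comes right after a strict descent (eqhead). *)
Fixpoint eqtail (b : bool) n s v : R :=
  if n is n'.+1 then
    (if b then eqtail true n' s.+1 v else \sum_(u < v.+1) eqtail true n' s.+1 u) +
    t * \sum_(u < s.+1 | (v < u)%N) eqtail false n' s.+1 u
  else 1.

Fixpoint eqhead (b : bool) n s v : R :=
  if n is n'.+1 then
    (if b then 0 else eqhead false n' s.+1 v + \sum_(u < v) eqhead true n' s.+1 u) +
    t * \sum_(u < s.+1 | (v < u)%N) eqhead false n' s.+1 u
  else 1.

(** In both families a run is determined by its length, first letter and last letter, and the ascent
    ending it depends only on the last letter and the position. *)
Lemma eqhead_eqtail n s v : eqhead false n s v = eqtail false n s v.
Proof.
pose U n s v := t * \sum_(u < s.+1 | (v < u)%N) eqtail false n s.+1 u.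
(* Puts [eqtail] in the form of the recurrence of [eqhead]: a run either stops at a second letter
   [u < v'], or loses one letter of its constant tail and remains a run from [v']. *)
have tailS m s' v' : eqtail false m.+1 s' v' = U m s' v' + eqtail false m s'.+1 v' +
    \sum_(u < v') (if m is k.+1 then U k s'.+1 u else 1).
  rewrite [LHS]/= addrC -/(U m s' v') -addrA; congr (_ + _).
  case: m => [|m]; first by rewrite big_ord_recr /= addrC.
  rewrite [eqtail false _ _ _]/= -/(U m s'.+1 v') -addrA.
  transitivity (\sum_(u < v'.+1) (eqtail true m s'.+2 u + U m s'.+1 u)).
    by apply: eq_bigr.
  by rewrite big_split; congr (_ + _); rewrite big_ord_recr /= addrC.
suff [] : (forall s v, eqhead false n s v = eqtail false n s v) /\
    (forall s v, eqhead true n s v = if n is k.+1 then U k s v else 1) by [].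
elim: n {s v} => [|n [IHf IHt]]; first by [].
have UE s v : t * \sum_(u < s.+1 | (v < u)%N) eqhead false n s.+1 u = U n s v.
  by congr (_ * _); apply: eq_bigr => u _.
split=> s v; last by rewrite /= UE add0r.
rewrite tailS [LHS]/= UE IHf addrC addrA; congr (_ + _).
by apply: eq_bigr => u _; apply: IHt.
Qed.

Lemma sum_le s v (F : nat -> R) : (v < s)%N ->
  \sum_(u < s | (u <= v)%N) F u = \sum_(u < v.+1) F u.
Proof. by move=> vs; rewrite (big_ord_widen _ F vs); apply: eq_bigl => u. Qed.

Lemma wt4_1342 n s z v : (v < s)%N ->
  wt4 t (fun s z y x => (x < y <= z)%N) n s z v = eqtail (v <= z)%N n s v.
Proof.
elim: n s z v => // n IH s z v vs; rewrite [LHS]/=.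
rewrite (sum_split _ _ _ (fun x => ~~ (x < v <= z)%N) (wt4 t _ n s.+1 v)).
congr (_ + t * _).
  case: (leqP v z) => vz.
    rewrite (eq_bigl (fun x : 'I_s.+1 => (x : nat) == v)) => [|x]; last by lia.
    by rewrite (big_ord1_eq _ (wt4 t _ n s.+1 v)) ltnS (ltnW vs) IH ?leqnn //; lia.
  rewrite -(sum_le (eqtail true n s.+1) (ltnW vs : v < s.+1)%N).
  apply: eq_big => [x|x /andP[_ xv]]; [by lia|by rewrite IH // xv].
apply: eq_big => [x|x /andP[_ vx]]; first by lia.
by rewrite IH // leqNgt vx.
Qed.

Lemma wt4_1243 n s z v : (v < s)%N ->
  wt4 t (fun s z y x => (x <= y < z)%N) n s z v = eqhead (v < z)%N n s v.
Proof.
elim: n s z v => // n IH s z v vs; rewrite [LHS]/=.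
rewrite (sum_split _ _ _ (fun x => ~~ (x <= v < z)%N) (wt4 t _ n s.+1 v)).
congr (_ + t * _).
  case: (ltnP v z) => vz; first by rewrite big_pred0 // => x; lia.
  transitivity (\sum_(u < v.+1) eqhead (u < v)%N n s.+1 u).
    rewrite -(sum_le (fun u => eqhead (u < v)%N n s.+1 u) (ltnW vs : v < s.+1)%N).
    by apply: eq_big => [x|x lx]; [lia|rewrite IH].
  rewrite big_ord_recr /= ltnn addrC; congr (_ + _).
  by apply: eq_bigr => u _; rewrite ltn_ord.
apply: eq_big => [x|x /andP[_ vx]]; first by lia.
by rewrite IH // ltnNge (ltnW vx).
Qed.

End Runs.

Local Close Scope ring_scope.

(** * Classification *)

Lemma word_Wilf_equiv_sym om om' : word_Wilf_equiv om om' -> word_Wilf_equiv om' om.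
Proof. by move=> e n m. Qed.

Lemma word_Wilf_equiv_trans om om' om'' :
  word_Wilf_equiv om om' -> word_Wilf_equiv om' om'' -> word_Wilf_equiv om om''.
Proof. by move=> e e' n m; rewrite e. Qed.

Lemma des_Wilf_equivE k (w w' : 'S_k) : 1 < k ->
  des_Wilf_equiv w w' <-> word_Wilf_equiv (oneline w) (oneline w').
Proof.
move=> k1; split=> [e [|n] m|e n m _].
(* Length 0 is outside [des_Wilf_equiv]; there both counts are those of the empty word. *)
- by [].
- by rewrite -(card_qc_avoids n.+1 w m k1) -(card_qc_avoids n.+1 w' m k1) e.
- by rewrite (card_qc_avoids n w m k1) (card_qc_avoids n w' m k1).
Qed.

Lemma wilf_132_312 : word_Wilf_equiv [:: 1; 3; 2] [:: 3; 1; 2].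
Proof.
apply: code3_word_Wilf_equiv code_132 code_312 _ => R t n.
(* From [s = 1] and [y = 0] both parameters are 0, so only height 0 is compared. *)
rewrite wt3_132 // wt3_312 //; have := motzkin_swap t 1 n 0.
by rewrite !expr0 !mul1r.
Qed.

Lemma wilf_1324_1423 : word_Wilf_equiv [:: 1; 3; 2; 4] [:: 1; 4; 2; 3].
Proof. exact: peak_word_Wilf_equiv code_1324 code_1423. Qed.

Lemma wilf_2314_2413 : word_Wilf_equiv [:: 2; 3; 1; 4] [:: 2; 4; 1; 3].
Proof. exact: peak_word_Wilf_equiv code_2314 code_2413. Qed.

Lemma wilf_1342_1243 : word_Wilf_equiv [:: 1; 3; 4; 2] [:: 1; 2; 4; 3].
Proof.
apply: code4_word_Wilf_equiv code_1342 code_1243 _ => R t n.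
(* The forced first rank 0 opens a run, and the two choices of the second rank are one step of the
   recurrence. *)
transitivity (eqtail t false n.+1 1 0).
  rewrite !big_ord_recl !big_ord0 !wt4_1342 //= big_ord_recl big_ord0 big_mkcond.
  by rewrite !big_ord_recl big_ord0 /= !addr0 add0r mul1r expr1.
rewrite -eqhead_eqtail !big_ord_recl !big_ord0 !wt4_1243 //= big_ord0 big_mkcond.
by rewrite !big_ord_recl big_ord0 /= !addr0 add0r mul1r expr1.
Qed.

(** * Separating classes by computed descent distributions *)

Definition signature (ns : seq nat) (om : seq nat) : seq (seq nat) :=
  [seq (let ds := map wdes (ext (occurs_at om) n [::]) in
        [seq count_mem m ds | m <- iota 0 n]) | n <- ns].

Lemma word_Wilf_equiv_signature ns om om' :
  word_Wilf_equiv om om' -> signature ns om = signature ns om'.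
Proof.
move=> e; apply: eq_map => n; apply: eq_map => m.
by have := e n m; rewrite !num_avoiders_ext !count_map.
Qed.

Lemma uniq_map_inj (T T' : eqType) (f : T -> T') (s : seq T) :
  uniq (map f s) -> {in s &, injective f}.
Proof.
move=> u x y xs ys e; rewrite -(nth_index x xs) -(nth_index x ys).
congr (nth _ _ _); apply/eqP.
rewrite -(nth_uniq (f x) _ _ u) ?size_map ?index_mem //.
by rewrite !(nth_map x) ?index_mem // !nth_index // e.
Qed.

Section Classification.
Variables (k : nat) (L : seq (seq (seq nat))) (ns : seq nat).
Hypotheses (k1 : 1 < k) (flL : perm_eq (flatten L) (permutations (iota 1 k))).
Hypothesis ntL : [::] \notin L.
Hypothesis eqL : forall l, l \in L -> forall om, om \in l -> word_Wilf_equiv (head [::] l) om.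
Hypothesis sigL : uniq [seq signature ns (head [::] l) | l <- L].

Let oneline_flatten : perm_eq [seq oneline w | w : 'S_k] (flatten L).
Proof. by rewrite (permPl (onelines_perm k)) perm_sym. Qed.

Let word_Wilf_equiv_class l l' om om' : l \in L -> l' \in L -> om \in l -> om' \in l' ->
  word_Wilf_equiv om om' <-> l = l'.
Proof.
move=> lL lL' oml oml'; split=> [e|ll'].
  apply: (uniq_map_inj sigL) => //; apply: word_Wilf_equiv_signature.
  apply: word_Wilf_equiv_trans (word_Wilf_equiv_sym (eqL lL' oml')).
  exact: word_Wilf_equiv_trans (eqL lL oml) e.
rewrite -ll' in oml'; exact: word_Wilf_equiv_trans (word_Wilf_equiv_sym (eqL lL oml)) (eqL lL oml').
Qed.

Let class_of (w : 'S_k) : exists2 l, l \in L & oneline w \in l.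
Proof.
have : oneline w \in flatten L by rewrite -(perm_mem oneline_flatten) map_f ?mem_enum.
by move=> /flattenP.
Qed.

Let class_rep l : l \in L -> exists w : 'S_k, oneline w \in l.
Proof.
move=> lL; have hl : head [::] l \in l.
  by case: l lL => [|om l _]; [rewrite (negbTE ntL)|rewrite inE eqxx].
have : head [::] l \in flatten L by apply/flattenP; exists l.
by rewrite -(perm_mem oneline_flatten) => /mapP[w _ e]; exists w; rewrite -e.
Qed.

Let listedP C : reflect (exists2 l, l \in L & C = [set w : 'S_k | oneline w \in l])
  (C \in listed_classes k L).
Proof. by rewrite inE; apply: (iffP mapP). Qed.

(** The lists partition the patterns by [flL]; [eqL] gives the equivalences within a list, and
    [sigL] separates different lists. *)
Lemma des_Wilf_classification :
  [/\ #|listed_classes k L| = size L,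
      (forall C : {set 'S_k}, des_Wilf_class C <-> C \in listed_classes k L) &
      (forall w w' : 'S_k,
         des_Wilf_equiv w w' <->
         exists2 C, C \in listed_classes k L & (w \in C) && (w' \in C))].
Proof.
have main (w w' : 'S_k) l : l \in L -> oneline w \in l ->
    des_Wilf_equiv w w' <-> oneline w' \in l.
  move=> lL wl; rewrite des_Wilf_equivE //; have [l' lL' wl'] := class_of w'.
  split=> [/(word_Wilf_equiv_class lL lL' wl wl') ->//|w'l].
  exact/(word_Wilf_equiv_class lL lL wl w'l).
split.
- rewrite cardsE; transitivity (size [seq [set w : 'S_k | oneline w \in l] | l <- L]).
    (* Lists defining the same set share the word of some permutation; being equivalent to itself,
       it forces them to coincide. *)
    apply/card_uniqP; rewrite map_inj_in_uniq ?(map_uniq sigL) // => l l' lL lL' e.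
    have [w wl] := class_rep lL; apply/(word_Wilf_equiv_class lL lL' wl) => //.
    by move/setP/(_ w): e; rewrite !inE wl => <-.
  by rewrite size_map.
- move=> C; split=> [[w wC]|/listedP[l lL ->]].
    have [l lL wl] := class_of w; apply/listedP; exists l => //.
    apply/setP => w'; rewrite inE; apply/idP/idP => [/wC/(main _ _ _ lL wl)//|w'l].
    exact/wC/(main _ _ _ lL wl).
  have [w wl] := class_rep lL; exists w => w'; rewrite inE.
  by apply: iff_sym; apply: main.
- move=> w w'; have [l lL wl] := class_of w; split=> [/(main _ _ _ lL wl) w'l|].
    exists [set v : 'S_k | oneline v \in l]; last by rewrite !inE wl.
    by apply/listedP; exists l.
  case=> C /listedP[l' lL' ->]; rewrite !inE => /andP[wl' w'l'].
  exact/(main _ _ _ lL' wl').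
Qed.

End Classification.

Lemma classes2_word_Wilf_equiv l : l \in classes2 ->
  forall om, om \in l -> word_Wilf_equiv (head [::] l) om.
Proof.
rewrite /classes2 !inE => /orP[] /eqP-> om; rewrite !inE => /eqP->; by [].
Qed.

Lemma classes3_word_Wilf_equiv l : l \in classes3 ->
  forall om, om \in l -> word_Wilf_equiv (head [::] l) om.
Proof.
move=> lL om; move: lL; rewrite !inE.
do 4! (case/predU1P => [->|]; first by rewrite inE => /eqP->).
move=> /eqP->; rewrite !inE => /orP[]/eqP-> //; exact: wilf_132_312.
Qed.

Lemma classes4_word_Wilf_equiv l : l \in classes4 ->
  forall om, om \in l -> word_Wilf_equiv (head [::] l) om.
Proof.
have e1 := wilf_3124_2314; have e2 := word_Wilf_equiv_trans e1 wilf_2314_2413.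
have e3 := wilf_2134_1324; have e4 := word_Wilf_equiv_trans e3 wilf_1324_1423.
have e5 := wilf_1342_1243.
(* Patterns of length 4 have letters from 1 to 4, so complementation is [5 - x]. *)
have f1 : word_Wilf_equiv [:: 2; 4; 3; 1] [:: 3; 2; 4; 1] :=
  @word_Wilf_equiv_compl 5 [:: 3; 1; 2; 4] [:: 2; 3; 1; 4] isT isT e1.
have f2 : word_Wilf_equiv [:: 2; 4; 3; 1] [:: 3; 1; 4; 2] :=
  @word_Wilf_equiv_compl 5 [:: 3; 1; 2; 4] [:: 2; 4; 1; 3] isT isT e2.
have f3 : word_Wilf_equiv [:: 3; 4; 2; 1] [:: 4; 2; 3; 1] :=
  @word_Wilf_equiv_compl 5 [:: 2; 1; 3; 4] [:: 1; 3; 2; 4] isT isT e3.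
have f4 : word_Wilf_equiv [:: 3; 4; 2; 1] [:: 4; 1; 3; 2] :=
  @word_Wilf_equiv_compl 5 [:: 2; 1; 3; 4] [:: 1; 4; 2; 3] isT isT e4.
have f5 : word_Wilf_equiv [:: 4; 3; 1; 2] [:: 4; 2; 1; 3] :=
  word_Wilf_equiv_sym (@word_Wilf_equiv_compl 5 [:: 1; 3; 4; 2] [:: 1; 2; 4; 3] isT isT e5).
move=> lL om; move: lL; rewrite !inE.
do 4! (case/predU1P => [->|]; first by rewrite !inE => /or3P[]/eqP->).
do 2! (case/predU1P => [->|]; first by rewrite !inE => /orP[]/eqP->).
do 7! (case/predU1P => [->|]; first by rewrite inE => /eqP->).
by move=> /eqP->; rewrite inE => /eqP->.
Qed.

Theorem mainTheorem2 :
  [/\ #|listed_classes 2 classes2| = 2,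
      (forall C : {set 'S_2},
         des_Wilf_class C <-> C \in listed_classes 2 classes2) &
      (forall w w' : 'S_2,
         des_Wilf_equiv w w' <->
         exists2 C, C \in listed_classes 2 classes2 & (w \in C) && (w' \in C))]
  /\
  [/\ #|listed_classes 3 classes3| = 5,
      (forall C : {set 'S_3},
         des_Wilf_class C <-> C \in listed_classes 3 classes3) &
      (forall w w' : 'S_3,
         des_Wilf_equiv w w' <->
         exists2 C, C \in listed_classes 3 classes3 & (w \in C) && (w' \in C))]
  /\
  [/\ #|listed_classes 4 classes4| = 14,
      (forall C : {set 'S_4},
         des_Wilf_class C <-> C \in listed_classes 4 classes4) &
      (forall w w' : 'S_4,
         des_Wilf_equiv w w' <->
         exists2 C, C \in listed_classes 4 classes4 & (w \in C) && (w' \in C))].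
Proof.
have p2 : perm_eq (flatten classes2) (permutations (iota 1 2)) by vm_compute.
have p3 : perm_eq (flatten classes3) (permutations (iota 1 3)) by vm_compute.
have p4 : perm_eq (flatten classes4) (permutations (iota 1 4)) by vm_compute.
(* Words of length 2, of length 4, and of lengths 5 and 6 together suffice to separate the classes
   of patterns of length 2, 3 and 4 respectively. *)
have s2 : uniq [seq signature [:: 2] (head [::] l) | l <- classes2] by vm_compute.
have s3 : uniq [seq signature [:: 4] (head [::] l) | l <- classes3] by vm_compute.
have s4 : uniq [seq signature [:: 5; 6] (head [::] l) | l <- classes4] by vm_compute.

split; first exact: (@des_Wilf_classification 2 classes2 _ isT p2 isT classes2_word_Wilf_equiv s2).
split; first exact: (@des_Wilf_classification 3 classes3 _ isT p3 isT classes3_word_Wilf_equiv s3).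
exact: (@des_Wilf_classification 4 classes4 _ isT p4 isT classes4_word_Wilf_equiv s4).
Qed.
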